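(* Let $n\equiv 0 \pmod 4$, let $V$ be an oriented $n$-dimensional Euclidean vector space, and let $T\in Cl_n^0(V)\cap Cl_n^{+}(V)$ satisfy $T^t=T$. If $Z_T=(0)$, then $\mathfrak g_T^{\star}$ is a perfect Lie algebra, i.e. $[\mathfrak g_T^{\star},\mathfrak g_T^{\star}]=\mathfrak g_T^{\star}$.
   Context: $Cl_n=Cl_n(V)$ is the real Clifford algebra of $(V,\langle\cdot,\cdot\rangle)$ with convention $v\cdot v=-|v|^2$; it is identified as a vector space with $\Lambda^*(V)$ via the canonical isomorphism, under which $e\cdot\varphi=e\wedge\varphi-e\lrcorner\varphi$ and $\varphi\cdot e=(-1)^k(e\wedge\varphi+e\lrcorner\varphi)$ for $e\in V\cong\Lambda^1(V)$, $\varphi\in\Lambda^k(V)$. Interior multiplication $X\lrcorner$ acts on $Cl_n$ through this identification. $(\cdot)^t$ is the anti-automorphism of $Cl_n$ with $(e_1e_2\cdots e_k)^t=e_k\cdots e_2e_1$ on products of vectors. $Cl_n^0$ is the span of even-degree forms. $\nu=e_1\cdots e_n$ (oriented orthonormal frame) is the volume element; for $n\equiv 0$ (mod 4), $\nu^2=1$ and $Cl_n^{\pm}=\{\varphi\in Cl_n:\nu\varphi=\pm\varphi\}$. $Cl_n$ is a Lie algebra under the commutator. The fix algebra $\mathfrak g_T^{\star}$ is the Lie subalgebra of $Cl_n$ generated by $\{X\lrcorner T:X\in V\}$. Let $S$ be an irreducible real $Cl_n$-module; the space of fixed spinors is $Z_T=\{\psi\in S:(X\lrcorner T)\psi=0\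 \text{for all }X\in V\}$. *)

(* Defs.v *)
From HB Require Import structures.
From mathcomp Require Import classical_sets reals.
From mathcomp Require Import all_boot all_order all_algebra sesquilinear ring.

Set Implicit Arguments.
Unset Strict Implicit.
Unset Printing Implicit Defensive.

Import Order.TTheory GRing.Theory Num.Theory.
Local Open Scope ring_scope.

(** Let [e_0, ..., e_(n-1)] be an orthonormal frame. The coefficient family
    [phi : clifford R n] stands for the sum over [A] of [phi A *: e_A], where
    [A = {a_1 < ... < a_k}] and [e_A] is the form [e_a1 /\ ... /\ e_ak],
    identified with the Clifford product [e_a1 ... e_ak]. *)
Definition clifford (R : comNzRingType) (n : nat) := {ffun {set 'I_n} -> R^o}.

HB.instance Definition _ (R : comNzRingType) (n : nat) :=
  Vector.copy (clifford R n) {ffun {set 'I_n} -> R^o}.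

Section SymmetricDifference.
Variable T : finType.
Implicit Types A B C : {set T}.

Definition symdiff A B : {set T} := (A :\: B) :|: (B :\: A).

Lemma in_symdiff A B x : (x \in symdiff A B) = (x \in A) (+) (x \in B).
Proof. by rewrite !inE; case: (x \in A); case: (x \in B). Qed.

Lemma symdiffA : associative symdiff.
Proof. by move=> A B C; apply/setP=> x; rewrite !in_symdiff addbA. Qed.

Lemma symdiff0s A : symdiff set0 A = A.
Proof. by apply/setP=> x; rewrite in_symdiff inE. Qed.

Lemma symdiffs0 A : symdiff A set0 = A.
Proof. by apply/setP=> x; rewrite in_symdiff inE addbF. Qed.

Lemma symdiff1 x A : symdiff [set x] A = if x \in A then A :\ x else x |: A.
Proof.
apply/setP=> y; rewrite in_symdiff !inE; case: ifP => xA; rewrite !inE;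
by case: eqVneq => [->|_]; rewrite ?xA.
Qed.

Lemma symdiffC A B : symdiff A B = symdiff B A.
Proof. by apply/setP=> x; rewrite !in_symdiff addbC. Qed.

End SymmetricDifference.

Section CliffordRing.
Variables (R : comNzRingType) (n : nat).
Local Notation Cl := (clifford R n).
Implicit Types (A B C : {set 'I_n}) (i j : 'I_n) (x y z : Cl).

Definition blade A : Cl := [ffun B => (B == A)%:R].
Definition gen i : Cl := blade [set i].

(** Reordering [e_A e_B] into [e_(symdiff A B)]: each [e_b] crosses the [e_a]
    with [b < a], and each [a] common to [A] and [B] yields [e_a e_a = -1]. *)
Definition clifford_sign A B : R :=
  (-1) ^+ #|[set p in setX A B | (p.2 <= p.1)%N]|.

Definition clifford_mul x y : Cl :=
  \sum_A \sum_B (x A * y B * clifford_sign A B) *: blade (symdiff A B).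

Lemma cliffordE x : x = \sum_A x A *: blade A.
Proof.
apply/ffunP=> B; rewrite sum_ffunE (bigD1 B) //= big1 ?addr0.
  by rewrite !ffunE eqxx /GRing.scale /= mulr1.
by move=> A nAB; rewrite !ffunE eq_sym (negPf nAB) scaler0.
Qed.

Lemma clifford_signE A B :
  clifford_sign A B = \prod_(a in A) \prod_(b in B) (-1) ^+ (b <= a)%N.
Proof.
rewrite /clifford_sign pair_big /= -sum1_card -prodrXr [LHS]big_mkcond.
rewrite [RHS]big_mkcond /=; apply: eq_bigr => -[a b] _; rewrite !inE /=.
by case: (a \in A); case: (b \in B); case: (b <= a)%N; rewrite ?expr0 ?expr1.
Qed.

Lemma prod_symdiff (F : 'I_n -> R) A B : (forall i, F i * F i = 1) ->
  \prod_(i in symdiff A B) F i = (\prod_(i in A) F i) * \prod_(i in B) F i.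
Proof.
move=> F2; rewrite ![\prod_(i in _) _]big_mkcond -big_split /=.
apply: eq_bigr => i _; rewrite in_symdiff.
by case: (i \in A); case: (i \in B); rewrite /= ?mulr1 ?mul1r ?F2.
Qed.

Lemma clifford_sign_symdiffl A B C :
  clifford_sign (symdiff A B) C = clifford_sign A C * clifford_sign B C.
Proof.
rewrite !clifford_signE prod_symdiff // => a.
rewrite -big_split big1 //= => b _.
by rewrite -expr2 sqrr_sign.
Qed.

Lemma clifford_sign_symdiffr A B C :
  clifford_sign A (symdiff B C) = clifford_sign A B * clifford_sign A C.
Proof.
rewrite !clifford_signE -big_split /=; apply: eq_bigr => a _.
by rewrite prod_symdiff // => b; rewrite -expr2 sqrr_sign.
Qed.

Lemma clifford_sign0s A : clifford_sign set0 A = 1.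
Proof. by rewrite clifford_signE big1 // => i; rewrite inE. Qed.

Lemma clifford_signs0 A : clifford_sign A set0 = 1.
Proof. by rewrite clifford_signE big1 // => i _; rewrite big_pred0 // => j; rewrite inE. Qed.

Fact clifford_mul_linearr x : linear (clifford_mul x).
Proof.
move=> a y z; rewrite /clifford_mul scaler_sumr -big_split; apply: eq_bigr => A _.
rewrite scaler_sumr -big_split; apply: eq_bigr => B _ /=.
by rewrite !ffunE scalerA -scalerDl /GRing.scale /= mulrDr mulrDl !mulrA (mulrC a).
Qed.

Fact clifford_mul_linearl y : linear (fun x => clifford_mul x y).
Proof.
move=> a x z; rewrite /clifford_mul scaler_sumr -big_split; apply: eq_bigr => A _.
rewrite scaler_sumr -big_split; apply: eq_bigr => B _ /=.
by rewrite !ffunE scalerA -scalerDl /GRing.scale /= !mulrDl !mulrA.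
Qed.

Definition clifford_mulr y x : Cl := clifford_mul x y.
HB.instance Definition _ x :=
  GRing.isLinear.Build R Cl Cl _ (clifford_mul x) (clifford_mul_linearr x).
HB.instance Definition _ y :=
  GRing.isLinear.Build R Cl Cl _ (clifford_mulr y) (clifford_mul_linearl y).

Lemma clifford_mul_blade A B :
  clifford_mul (blade A) (blade B) = clifford_sign A B *: blade (symdiff A B).
Proof.
rewrite /clifford_mul (bigD1 A) //= (bigD1 B) //= !ffunE !eqxx !mul1r.
rewrite big1 ?addr0 => [|D nDB]; last by rewrite !ffunE (negPf nDB) mulr0 mul0r scale0r.
rewrite big1 ?addr0 // => D nDA; apply: big1 => E _.
by rewrite !ffunE (negPf nDA) !mul0r scale0r.
Qed.

Lemma clifford_linear_eq (W : lmodType R) (f g : {linear Cl -> W}) :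
  (forall A, f (blade A) = g (blade A)) -> f =1 g.
Proof.
move=> fg x; rewrite (cliffordE x) !linear_sum.
by apply: eq_bigr => A _; rewrite !linearZ fg.
Qed.

Fact clifford_mulA : associative clifford_mul.
Proof.
move=> x y z.
transitivity ((clifford_mul x \o clifford_mulr z) y); first by [].
transitivity ((clifford_mulr z \o clifford_mul x) y); last by [].
apply: clifford_linear_eq y => B /=.
transitivity ((clifford_mul x \o clifford_mul (blade B)) z); first by [].
transitivity ((clifford_mul (clifford_mul x (blade B))) z); last by [].
apply: clifford_linear_eq z => C /=.
transitivity (clifford_mulr (clifford_mul (blade B) (blade C)) x); first by [].
transitivity ((clifford_mulr (blade C) \o clifford_mulr (blade B)) x); last by [].
apply: clifford_linear_eq x => A /=.
rewrite /clifford_mulr !clifford_mul_blade linearZ /= clifford_mul_blade.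
rewrite -[RHS]/(clifford_mulr (blade C) (clifford_sign A B *: blade (symdiff A B))).
rewrite [RHS]linearZ /= /clifford_mulr clifford_mul_blade !scalerA symdiffA.
rewrite clifford_sign_symdiffl clifford_sign_symdiffr.
by congr (_ *: _); rewrite [LHS]mulrC -!mulrA.
Qed.

Fact clifford_mul1r : left_id (blade set0) clifford_mul.
Proof.
apply: (clifford_linear_eq (f := clifford_mul (blade set0)) (g := idfun)) => A /=.
by rewrite clifford_mul_blade clifford_sign0s symdiff0s scale1r.
Qed.

Fact clifford_mulr1 : right_id (blade set0) clifford_mul.
Proof.
apply: (clifford_linear_eq (f := clifford_mulr (blade set0)) (g := idfun)) => A /=.
by rewrite /clifford_mulr clifford_mul_blade clifford_signs0 symdiffs0 scale1r.
Qed.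

Fact clifford_mulDl : left_distributive clifford_mul +%R.
Proof. by move=> x y z; apply: (linearD (clifford_mulr z)). Qed.

Fact clifford_mulDr : right_distributive clifford_mul +%R.
Proof. by move=> x y z; apply: linearD. Qed.

Fact clifford_1_neq0 : blade set0 != 0.
Proof.
by apply/eqP => /ffunP /(_ set0) /eqP; rewrite !ffunE eqxx oner_eq0.
Qed.

HB.instance Definition _ := GRing.Zmodule_isNzRing.Build Cl
  clifford_mulA clifford_mul1r clifford_mulr1 clifford_mulDl clifford_mulDr
  clifford_1_neq0.

Fact clifford_scaleAl (a : R) x y : a *: (x * y) = (a *: x) * y.
Proof. by rewrite -[RHS]/(clifford_mulr y (a *: x)) linearZ. Qed.

Fact clifford_scaleAr (a : R) x y : a *: (x * y) = x * (a *: y).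
Proof. by rewrite -[RHS]/(clifford_mul x (a *: y)) linearZ. Qed.

HB.instance Definition _ := GRing.Lmodule_isLalgebra.Build R Cl clifford_scaleAl.
HB.instance Definition _ := GRing.Lalgebra_isAlgebra.Build R Cl clifford_scaleAr.

Lemma blade_mul A B : blade A * blade B = clifford_sign A B *: blade (symdiff A B).
Proof. exact: clifford_mul_blade. Qed.

End CliffordRing.

Section CliffordForms.
Variables (R : comNzRingType) (n : nat).
Local Notation Cl := (clifford R n).
Implicit Types (A B : {set 'I_n}) (i j : 'I_n) (x y : Cl).

Definition is_form (k : nat) x := forall A, x A != 0 -> #|A| = k.
Definition is_even x := forall A, x A != 0 -> ~~ odd #|A|.

Definition before i A : {set 'I_n} := [set a in A | (a < i)%N].

Definition wedge_gen i x : Cl :=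
  \sum_(A : {set _} | i \notin A) x A *: ((-1) ^+ #|before i A| *: blade R (i |: A)).

Definition interior_gen i x : Cl :=
  \sum_(A : {set _} | i \in A) x A *: ((-1) ^+ #|before i A| *: blade R (A :\ i)).

(** The frame is understood to be positively oriented. *)
Definition volume : Cl := \prod_(i < n) gen R i.

(** [e_A ^t = e_ak ... e_a1] for [A = {a_1 < ... < a_k}]. *)
Definition reversal x : Cl :=
  \sum_A x A *: \prod_(i <- rev (enum A)) gen R i.

Lemma card_before i A : #|before i A| = (\sum_(a in A) (a < i))%N.
Proof.
rewrite -sum1_card big_mkcond [RHS]big_mkcond; apply: eq_bigr => a _.
by rewrite inE; case: (a \in A); case: (a < i)%N.
Qed.

Lemma sign_gen_blade i A :
  clifford_sign R [set i] A = (-1) ^+ (i \in A) * (-1) ^+ #|before i A|.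
Proof.
rewrite clifford_signE big_set1 prodrXr -exprD card_before; congr (_ ^+ _).
case: (boolP (i \in A)) => iA; rewrite ?add0n.
  rewrite (bigD1 i) //= [in RHS](bigD1 i) //= leqnn ltnn; congr (_ + _)%N.
  by apply: eq_bigr => b /andP[_ nbi]; rewrite [in RHS]ltn_neqAle nbi.
apply: eq_bigr => b bA; rewrite [in RHS]ltn_neqAle.
by have -> : val b != val i by apply: contraNneq iA => /val_inj <-.
Qed.

Lemma sign_blade_gen i A :
  clifford_sign R A [set i] = (-1) ^+ #|A| * (-1) ^+ #|before i A|.
Proof.
rewrite clifford_signE card_before -sum1_card -!prodrXr -big_split /=.
apply: eq_bigr => a _; rewrite big_set1 ltnNge.
by case: leqP; rewrite /= ?expr0 ?expr1 ?mulr1 // mulrNN mulr1.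
Qed.

Lemma gen_mul_blade i A :
  gen R i * blade R A =
  if i \in A then - ((-1) ^+ #|before i A| *: blade R (A :\ i))
  else (-1) ^+ #|before i A| *: blade R (i |: A).
Proof.
rewrite blade_mul sign_gen_blade symdiff1; case: ifP => _.
  by rewrite expr1 mulN1r scaleNr.
by rewrite mul1r.
Qed.

Lemma blade_mul_gen i A :
  blade R A * gen R i =
  (-1) ^+ #|A| *: ((-1) ^+ #|before i A| *:
                   blade R (if i \in A then A :\ i else i |: A)).
Proof. by rewrite blade_mul sign_blade_gen symdiffC symdiff1 scalerA. Qed.

Lemma gen_mul i x : gen R i * x = wedge_gen i x - interior_gen i x.
Proof.
rewrite {1}(cliffordE x) mulr_sumr (bigID (fun A : {set _} => i \in A)) /= addrC.
congr (_ + _).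
  by apply: eq_bigr => A iA; rewrite -scalerAr gen_mul_blade (negPf iA).
rewrite -sumrN; apply: eq_bigr => A iA.
by rewrite -scalerAr gen_mul_blade iA scalerN.
Qed.

Lemma mul_gen k i x : is_form k x ->
  x * gen R i = (-1) ^+ k *: (wedge_gen i x + interior_gen i x).
Proof.
move=> xk; rewrite {1}(cliffordE x) mulr_suml (bigID (fun A : {set _} => i \in A)) /= addrC.
have E A : x A *: (blade R A * gen R i) = (-1) ^+ k *: (x A *:
    ((-1) ^+ #|before i A| *: blade R (if i \in A then A :\ i else i |: A))).
  have [->|/xk kA] := eqVneq (x A) 0; first by rewrite !scale0r scaler0.
  by rewrite blade_mul_gen kA !scalerA; congr (_ *: _); rewrite !mulrA (mulrC (x A)).
rewrite scalerDr !scaler_sumr; congr (_ + _); apply: eq_bigr => A iA.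
  by rewrite -scalerAl E (negPf iA).
by rewrite -scalerAl E iA.
Qed.

Lemma gen_sqr i : gen R i * gen R i = -1.
Proof.
rewrite [in X in _ * X]/gen gen_mul_blade set11.
have -> : before i [set i] = set0.
  by apply/setP=> a; rewrite !inE; case: eqVneq => //= ->; rewrite ltnn.
by rewrite cards0 expr0 scale1r setDv.
Qed.

Lemma gen_anticomm i j : i != j -> gen R i * gen R j = - (gen R j * gen R i).
Proof.
move=> nij; rewrite /gen !blade_mul symdiffC sign_gen_blade sign_blade_gen.
by rewrite cards1 expr1 inE (negPf nij) mul1r mulN1r scaleNr opprK.
Qed.

Lemma sorted_enum A : sorted (fun i j : 'I_n => (i < j)%N) (enum A).
Proof.
rewrite /enum_mem -enumT; apply: sorted_filter => [? ? ?|]; first exact: ltn_trans.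
by have := iota_ltn_sorted 0 n; rewrite -val_enum_ord sorted_map.
Qed.

Lemma enum_sorted (s : seq 'I_n) A :
  sorted (fun i j : 'I_n => (i < j)%N) s -> s =i A -> enum A = s.
Proof.
move=> ss sA; apply: (irr_sorted_eq _ _ (sorted_enum A) ss) => [? ? ?|?|?].
- exact: ltn_trans.
- exact: ltnn.
- by rewrite mem_enum sA.
Qed.

Lemma enum_ind (P : {set 'I_n} -> seq 'I_n -> Prop) : P set0 [::] ->
  (forall i A, i \notin A -> before i A = set0 -> P A (enum A) ->
     P (i |: A) (i :: enum A)) ->
  forall A, P A (enum A).
Proof.
move=> P0 PS A; have := sorted_enum A.
have : enum A =i A by move=> i; rewrite mem_enum.
move: (enum A) => s; elim: s A => [|i s IHs] A sA ss.
  by have -> : A = set0 by apply/setP=> i; rewrite -sA inE.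
have := ss; rewrite /= path_sortedE; last by move=> ? ? ?; apply: ltn_trans.
case/andP=> /allP is_lt s's.
have eA : A = i |: [set j in s] by apply/setP=> j; rewrite -sA !inE.
have es : enum [set j in s] = s by apply: enum_sorted => // j; rewrite inE.
rewrite eA -{2}es; apply: PS.
- by rewrite inE; apply/negP => /is_lt; rewrite ltnn.
- apply/setP=> j; rewrite !inE; apply/negP => /andP[/is_lt ij ji].
  by have := ltn_trans ij ji; rewrite ltnn.
- by rewrite es; apply: IHs => // j; rewrite inE.
Qed.

Lemma bladeE A : blade R A = \prod_(i <- enum A) gen R i.
Proof.
pose P (B : {set 'I_n}) s := blade R B = \prod_(i <- s) gen R i.
apply: (@enum_ind P) => [|i B iB bB IH]; rewrite /P ?big_nil // big_cons -IH.
by rewrite gen_mul_blade (negPf iB) bB cards0 scale1r.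
Qed.

Lemma prod_rev_enum A :
  \prod_(i <- rev (enum A)) gen R i = (-1) ^+ 'C(#|A|, 2) *: blade R A.
Proof.
pose P (B : {set 'I_n}) s :=
  \prod_(i <- rev s) gen R i = (-1) ^+ 'C(#|B|, 2) *: blade R B.
apply: (@enum_ind P) => [|i B iB bB IH]; rewrite /P.
  by rewrite big_nil cards0 expr0 scale1r.
rewrite rev_cons big_rcons IH /= -scalerAl blade_mul_gen (negPf iB) bB cards0.
by rewrite expr0 scale1r scalerA -exprD cardsU1 iB binS bin1 addnC.
Qed.

Fact reversal_linear : linear reversal.
Proof.
move=> a x y; rewrite scaler_sumr -big_split; apply: eq_bigr => A _ /=.
by rewrite !ffunE scalerA -scalerDl.
Qed.

HB.instance Definition _ :=
  GRing.isLinear.Build R Cl Cl _ reversal reversal_linear.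

Lemma reversal_blade A : reversal (blade R A) = \prod_(i <- rev (enum A)) gen R i.
Proof.
rewrite /reversal (bigD1 A) //= ffunE eqxx scale1r [X in _ + X]big1 ?addr0 // => B nBA.
by rewrite ffunE (negPf nBA) scale0r.
Qed.

Lemma reversal_gen i : reversal (gen R i) = gen R i.
Proof. by rewrite reversal_blade enum_set1 big_seq1. Qed.

Lemma reversal1 : reversal 1 = 1.
Proof. by rewrite reversal_blade enum_set0 big_nil. Qed.

Lemma reversal_gen_mul i x : reversal (gen R i * x) = reversal x * gen R i.
Proof.
transitivity ((reversal \o @clifford_mul R n (gen R i)) x); first by [].
transitivity ((clifford_mulr (gen R i) \o reversal) x); last by [].
apply: clifford_linear_eq x => A /=.
rewrite -[clifford_mul _ _]/(gen R i * blade R A) gen_mul_blade.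
rewrite reversal_blade -[RHS]/(_ * gen R i) prod_rev_enum -scalerAl.
rewrite blade_mul_gen; case: ifP => iA.
  rewrite -scaleNr linearZ /= reversal_blade prod_rev_enum !scalerA.
  rewrite (cardsD1 i A) iA add1n binS bin1 exprD !exprS; congr (_ *: _).
  move: #|A :\ i| #|before i A| => k m.
  have kk : (-1) ^+ k * (-1) ^+ k = 1 :> R by rewrite -expr2 sqrr_sign.
  by ring: kk.
rewrite linearZ /= reversal_blade prod_rev_enum !scalerA cardsU1 iA binS bin1.
by rewrite exprD; congr (_ *: _); rewrite mulrC -!mulrA; congr (_ * _).
Qed.

Lemma reversalM x y : reversal (x * y) = reversal y * reversal x.
Proof.
transitivity ((reversal \o clifford_mulr y) x); first by [].
transitivity ((clifford_mul (reversal y) \o reversal) x); last by [].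
apply: clifford_linear_eq x => A /=.
rewrite -[clifford_mulr _ _]/(blade R A * y) -[RHS]/(reversal y * _) bladeE.
elim: (enum A) => [|i s IHs]; first by rewrite big_nil mul1r reversal1 mulr1.
by rewrite big_cons -mulrA !reversal_gen_mul IHs mulrA.
Qed.

End CliffordForms.

Section UniversalProperty.
Variables (R : comNzRingType) (n : nat) (W : algType R) (f : 'I_n -> W).
Hypothesis f_sqr : forall i, f i * f i = -1.
Hypothesis f_anticomm : forall i j, i != j -> f i * f j = - (f j * f i).
Local Notation Cl := (clifford R n).

Definition clifford_lift (x : Cl) : W := \sum_A x A *: \prod_(i <- enum A) f i.

Let lift_linear : linear clifford_lift.
Proof.
move=> a x y; rewrite scaler_sumr -big_split; apply: eq_bigr => A _ /=.
by rewrite !ffunE scalerA -scalerDl.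
Qed.
HB.instance Definition _ := GRing.isLinear.Build R Cl W _ clifford_lift lift_linear.

Let lift_blade A : clifford_lift (blade R A) = \prod_(i <- enum A) f i.
Proof.
rewrite /clifford_lift (bigD1 A) //= ffunE eqxx scale1r [X in _ + X]big1 ?addr0 // => B nBA.
by rewrite ffunE (negPf nBA) scale0r.
Qed.

Let enum_setU1 i (A : {set 'I_n}) : i \notin A -> before i A = set0 ->
  enum (i |: A) = i :: enum A.
Proof.
move=> iA bA; apply: enum_sorted => [|j]; last by rewrite !inE mem_enum.
have lt_tr : transitive (fun i j : 'I_n => (i < j)%N).
  by move=> ? ? ?; apply: ltn_trans.
rewrite /= (path_sortedE lt_tr) sorted_enum andbT; apply/allP => j.
rewrite mem_enum => jA; move/setP/(_ j): bA; rewrite !inE jA /= ltnNge => /negbFE.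
rewrite leq_eqVlt => /orP[/eqP/val_inj ij|//].
by rewrite ij jA in iA.
Qed.

Let lift_gen_blade i A :
  f i * clifford_lift (blade R A) = clifford_lift (gen R i * blade R A).
Proof.
rewrite lift_blade.
pose P (B : {set 'I_n}) s := f i * \prod_(j <- s) f j = clifford_lift (gen R i * blade R B).
apply: (@enum_ind _ P) => [|a B aB bB IH]; rewrite /P.
  by rewrite -[blade R _]/(1 : Cl) big_nil !mulr1 /gen lift_blade enum_set1 big_seq1.
have E : blade R (a |: B) = gen R a * blade R B.
  by rewrite gen_mul_blade (negPf aB) bB cards0 scale1r.
rewrite big_cons -lift_blade E.
have [->|nia] := eqVneq i a.
  by rewrite !mulrA f_sqr gen_sqr !mulN1r linearN.
case: (ltngtP i a) => [ia|ai|/val_inj ia]; last by rewrite ia eqxx in nia.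
  have iaB : i \notin a |: B.
    rewrite !inE negb_or nia; apply/negP => iB.
    by move/setP/(_ i): bB; rewrite !inE iB ia.
  have baB : before i (a |: B) = set0.
    apply/setP=> b; rewrite !inE; apply/negP => /andP[/orP[/eqP->|bB'] bi].
      by have := ltn_trans ia bi; rewrite ltnn.
    by move/setP/(_ b): bB; rewrite !inE bB' (ltn_trans bi ia).
  rewrite -E gen_mul_blade (negPf iaB) baB cards0 expr0 scale1r !lift_blade.
  by rewrite (enum_setU1 iaB baB) big_cons (enum_setU1 aB bB) big_cons.
pose C := symdiff [set i] B.
have aC : a \notin C by rewrite in_symdiff inE eq_sym (negPf nia).
have bC : before a C = set0.
  apply/setP=> b; rewrite inE in_set0 in_symdiff inE.
  apply/negP => /andP[+ ba].
  have nbi : b != i by apply: contraTneq ba => ->; rewrite -leqNgt ltnW.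
  rewrite (negPf nbi) addFb => bB'.
  by move/setP/(_ b): bB; rewrite !inE bB' ba.
have LC : clifford_lift (gen R a * blade R C) = f a * clifford_lift (blade R C).
  rewrite gen_mul_blade (negPf aC) bC cards0 expr0 scale1r !lift_blade.
  by rewrite enum_setU1 // big_cons.
rewrite mulrA f_anticomm // mulNr -mulrA lift_blade IH.
rewrite [in RHS]mulrA (gen_anticomm _ nia) mulNr linearN -mulrA; congr (- _).
by rewrite blade_mul -scalerAr !linearZ /= LC -scalerAr.
Qed.

Let lift_gen_mul i x : clifford_lift (gen R i * x) = f i * clifford_lift x.
Proof.
rewrite (cliffordE x) mulr_sumr !linear_sum mulr_sumr; apply: eq_bigr => A _.
by rewrite -scalerAr !linearZ /= -scalerAr lift_gen_blade.
Qed.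

Let lift1 : clifford_lift 1 = 1.
Proof. by rewrite lift_blade enum_set0 big_nil. Qed.

Let liftM : {morph clifford_lift : x y / x * y}.
Proof.
move=> x y; rewrite (cliffordE x) mulr_suml !linear_sum mulr_suml.
apply: eq_bigr => A _; rewrite -scalerAl !linearZ /= -scalerAl; congr (_ *: _).
rewrite bladeE; elim: (enum A) => [|i s IHs]; first by rewrite big_nil lift1 !mul1r.
by rewrite big_cons -mulrA !lift_gen_mul IHs mulrA.
Qed.
Lemma clifford_lift_exists :
  exists g : {lrmorphism Cl -> W}, forall i, g (gen R i) = f i.
Proof.
pose g : {lrmorphism Cl -> W} := HB.pack clifford_lift
  (GRing.isLinear.Build R Cl W _ clifford_lift lift_linear)
  (GRing.isMonoidMorphism.Build Cl W clifford_lift (conj lift1 liftM)).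
exists g => i.
by have := lift_blade [set i]; rewrite enum_set1 big_seq1.
Qed.

End UniversalProperty.

Lemma clifford_lift_unique (R : comNzRingType) (n : nat) (W : algType R)
    (g h : {lrmorphism clifford R n -> W}) :
  (forall i, g (gen R i) = h (gen R i)) -> g =1 h.
Proof.
move=> gh; apply: clifford_linear_eq => A.
by rewrite bladeE !rmorph_prod; apply: eq_bigr => i _; apply: gh.
Qed.

Section EuclideanSpace.
Variables (R : realType) (n : nat) (V : vectType R).
Variables (ip : {dot V for idfun}) (e : n.-tuple V).
Local Notation Cl := (clifford R n).

(** Meaningful when [o], the basis orienting [V], and [e] are both bases. *)
Definition same_orientation (o : n.-tuple V) :=
  0 < \det (\matrix_(i < n, j < n) coord o j (tnth e i)).

(** [e] is the orthonormal frame through which [Cl_n(V)] and the exterior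
    algebra of [V] are identified with [clifford R n]: [vector_sqr] and
    [clifford_universal] show that [vector : V -> clifford R n] is then the
    Clifford algebra of [(V, ip)], while [vector_mul] and [mul_vector] relate
    its product to [wedge] and [interior]. *)
Definition vector (v : V) : Cl := \sum_i ip v (tnth e i) *: gen R i.

Definition wedge (v : V) (x : Cl) : Cl :=
  \sum_i ip v (tnth e i) *: wedge_gen i x.

Definition interior (v : V) (x : Cl) : Cl :=
  \sum_i ip v (tnth e i) *: interior_gen i x.

Lemma vector_mul v x : vector v * x = wedge v x - interior v x.
Proof.
rewrite mulr_suml -sumrB; apply: eq_bigr => i _.
by rewrite -scalerAl gen_mul scalerBr.
Qed.

Lemma mul_vector k v x : is_form k x ->
  x * vector v = (-1) ^+ k *: (wedge v x + interior v x).
Proof.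
move=> xk; rewrite mulr_sumr -big_split scaler_sumr; apply: eq_bigr => i _ /=.
by rewrite -scalerAr (mul_gen _ xk) scalerA mulrC -scalerA scalerDr.
Qed.

Lemma reversal_vector v : reversal (vector v) = vector v.
Proof.
by rewrite linear_sum; apply: eq_bigr => i _; rewrite linearZ /= reversal_gen.
Qed.

Fact vector_linear : linear vector.
Proof.
move=> a u v; rewrite scaler_sumr -big_split; apply: eq_bigr => i _ /=.
by rewrite linearPl scalerDl scalerA.
Qed.
HB.instance Definition _ := GRing.isLinear.Build R V Cl _ vector vector_linear.

Hypotheses (dimV : \dim {:V} = n) (e_on : orthonormal ip e).

Let ipC u v : ip u v = ip v u.
Proof. by rewrite hermC expr0 mul1r. Qed.
Let ipZl a u v : ip (a *: u) v = a * ip u v.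
Proof. exact: linearZl_LR. Qed.
Let ipDl u v w : ip (u + v) w = ip u w + ip v w.
Proof. exact: linearDl. Qed.
Let ip_suml (F : 'I_n -> V) w : ip (\sum_i F i) w = \sum_i ip (F i) w.
Proof. exact: linear_sumlz. Qed.

Lemma orthonormal_frameE (i j : 'I_n) : ip (tnth e i) (tnth e j) = (i == j)%:R.
Proof.
have ltE (k l : 'I_n) : (k < l)%N -> ip (tnth e k) (tnth e l) = 0.
  move=> kl; rewrite !(tnth_nth 0).
  have [_] := andP e_on; have : (l < size e)%N by rewrite size_tuple.
  elim: (tval e) (val k) (val l) kl => [|v s IHs] //= [|k'] [|l'] //= kl' ls.
    by rewrite /= andbT => /andP[/allP + _] => /(_ _ (mem_nth 0 ls)) /eqP.
  by case/andP=> _; apply: IHs.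
case: eqVneq => [->|nij].
  by have [/allP/(_ _ (mem_tnth j e))/eqP -> _] := andP e_on.
case: (ltngtP i j) => [/ltE -> //|/ltE ji|/val_inj ij]; first by rewrite ipC ji.
by rewrite ij eqxx in nij.
Qed.

Lemma vector_frame i : vector (tnth e i) = gen R i.
Proof.
rewrite /vector (bigD1 i) //= orthonormal_frameE eqxx scale1r big1 ?addr0 // => j.
by rewrite orthonormal_frameE eq_sym => /negPf->; rewrite scale0r.
Qed.

Lemma frame_expansion v : v = \sum_i ip v (tnth e i) *: tnth e i.
Proof.
have frE : free e.
  apply/freeP => k k0 i.
  have := congr1 (fun u => ip u (tnth e i)) k0.
  rewrite ip_suml linear0l (bigD1 i) //= ipZl.
  rewrite -tnth_nth orthonormal_frameE eqxx /= mulr1 big1 ?addr0 // => j nji.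
  by rewrite ipZl -tnth_nth orthonormal_frameE (negPf nji) /= mulr0.
have beE : basis_of fullv e.
  by rewrite basisEfree frE subvf dimV size_tuple leqnn.
have vE := coord_basis beE (memvf v).
rewrite {1}vE; apply: eq_bigr => i _; rewrite -tnth_nth; congr (_ *: _).
rewrite {2}vE ip_suml (bigD1 i) //= ipZl.
rewrite -tnth_nth orthonormal_frameE eqxx /= mulr1 big1 ?addr0 // => j nji.
by rewrite ipZl -tnth_nth orthonormal_frameE (negPf nji) /= mulr0.
Qed.

Lemma vector_sqr v : vector v * vector v = - (ip v v)%:A.
Proof.
have -> : ip v v = \sum_i ip v (tnth e i) ^+ 2.
  rewrite {1}(frame_expansion v) ip_suml; apply: eq_bigr => i _.
  by rewrite ipZl (ipC _ v) expr2.
have H (m : nat) (c : 'I_m -> R) (g : 'I_m -> Cl) :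
    (forall i, g i * g i = -1) -> (forall i j, i != j -> g i * g j = - (g j * g i)) ->
    (\sum_i c i *: g i) * (\sum_i c i *: g i) = - (\sum_i c i ^+ 2)%:A.
  move=> g2 ga; elim: m c g g2 ga => [|m IHm] c g g2 ga.
    by rewrite !big_ord0 mul0r scale0r oppr0.
  rewrite !big_ord_recl mulrDl !mulrDr IHm => [|i|i j nij]; first last.
  - by apply: ga; rewrite (inj_eq lift_inj).
  - exact: g2.
  rewrite -!scalerAl -!scalerAr g2 scalerA -expr2 scalerN scalerDl opprD.
  rewrite addrACA -[RHS]addr0 -addrA [RHS]addrAC -addrA; congr (_ + _).
  rewrite sub0r addrA -scalerDr mulr_sumr mulr_suml -big_split big1 => [|i _] /=.
    by rewrite scaler0 add0r.
  by rewrite -scalerAr -scalerAl [g ord0 * _]ga // scalerN addrN.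
by apply: H => [i|i j nij]; [apply: gen_sqr | apply: gen_anticomm].
Qed.

Lemma clifford_universal (W : algType R) (f : {linear V -> W}) :
  (forall v, f v * f v = - (ip v v)%:A) ->
  exists2 g : {lrmorphism Cl -> W}, (forall v, g (vector v) = f v) &
    forall h : {lrmorphism Cl -> W}, (forall v, h (vector v) = f v) -> h =1 g.
Proof.
move=> f2.
have fi i : f (tnth e i) * f (tnth e i) = -1.
  by rewrite f2 orthonormal_frameE eqxx scale1r.
have fij i j : i != j -> f (tnth e i) * f (tnth e j) = - (f (tnth e j) * f (tnth e i)).
  move=> nij; have := f2 (tnth e i + tnth e j).
  have -> : ip (tnth e i + tnth e j) (tnth e i + tnth e j) = 1 + 1.
    rewrite ipDl !(ipC _ (_ + _)) !ipDl !orthonormal_frameE !eqxx eq_sym (negPf nij).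
    by rewrite addr0 add0r.
  rewrite linearD mulrDl !mulrDr !fi scalerDl scale1r opprD => fij.
  apply/eqP; rewrite -addr_eq0; apply/eqP; move: fij.
  by rewrite -!addrA => /addrI; rewrite addrA -[RHS]add0r => /addIr.
have [g gE] := clifford_lift_exists fi fij.
have gvE v : g (vector v) = f v.
  rewrite {2}(frame_expansion v) !linear_sum; apply: eq_bigr => i _.
  by rewrite !linearZ /= gE.
exists g => // h hE; apply: clifford_lift_unique => i.
by rewrite -vector_frame hE gvE.
Qed.

End EuclideanSpace.

Definition linear_subspace (R : nzRingType) (W : lmodType R) (U : set W) : Prop :=
  U 0 /\ forall (a : R) (x y : W), U x -> U y -> U (a *: x + y).

Section LieAlgebra.
Variables (R : comNzRingType) (W : algType R).
Implicit Types (x y : W) (U : set W).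

Definition lie x y := x * y - y * x.

Definition lie_subalgebra U : Prop :=
  linear_subspace U /\ forall x y, U x -> U y -> U (lie x y).

Definition generated_lie_subalgebra (G : set W) : set W :=
  smallest lie_subalgebra G.

Definition derived_algebra U : set W :=
  smallest (@linear_subspace R W)
    [set z | exists x y, [/\ U x, U y & z = lie x y]]%classic.

Definition perfect_lie_algebra U : Prop := derived_algebra U = U.

End LieAlgebra.

(** When [A] is a real algebra, the real vector space structure of [S] is the
    restriction of the action of [A] to the scalars. *)
Definition irreducible_module (A : nzRingType) (S : lmodType A) : Prop :=
  (exists s : S, s <> 0) /\
  forall U : set S, linear_subspace U ->
    U = [set 0]%classic \/ U = classical_sets.setT.

Section FixAlgebra.
Variables (R : realType) (n : nat) (V : vectType R).
Variables (ip : {dot V for idfun}) (e : n.-tuple V) (T : clifford R n).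

Definition fix_algebra : set (clifford R n) :=
  generated_lie_subalgebra [set interior ip e X T | X in classical_sets.setT]%classic.

Definition fixed_spinors (S : lmodType (clifford R n)) : set S :=
  [set psi : S | forall X : V, interior ip e X T *: psi = 0]%classic.

End FixAlgebra.

Arguments fixed_spinors {R n V} ip e T S.

(* Main.v *)
(** Since [T] is even, [X _| T] is [[T, X] / 2]; it is odd, and self-adjoint for
    the adjoint [star] with respect to the inner product on coefficients. Hence
    [g] is stable under [star], and an element [z] of [g] orthogonal to [[g, g]]
    centralizes [g]. The odd part [y] of such a [z] commutes with all
    [[T, e_i]]; as [T = nu T = T nu], this forces [e_i (T y) e_i = y T] for all
    [i], which by parity is possible only if [T y = 0]. As there are no fixed
    spinors, [T] is injective on [S^+], so that [(1 + nu) y] acts as [0] on [S],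
    hence vanishes; applying this to [star y] too gives [y = 0]. So [z] is even,
    hence orthogonal to every [X _| T] as well as to [[g, g]]; these span [g],
    and [z = 0]. *)

From HB Require Import structures.
Require Import Defs.
From mathcomp Require Import classical_sets reals.
From mathcomp Require Import all_boot all_order all_algebra sesquilinear.
From mathcomp Require Import boolp ring lra.
Import GRing.Theory.
Local Open Scope ring_scope.
Import Num.Theory.

Set Implicit Arguments.
Unset Strict Implicit.
Unset Printing Implicit Defensive.

(** * The adjoint, the inner product on coefficients and the trace *)

Section CliffordStar.
Variables (R : comNzRingType) (n : nat).
Local Notation Cl := (clifford R n).
Local Notation sgn := (@clifford_sign R n).
Implicit Types (A B C : {set 'I_n}) (i j : 'I_n) (x y z : Cl).

Lemma clifford_sign_sqr A B : sgn A B * sgn A B = 1.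
Proof. by rewrite /clifford_sign -expr2 sqrr_sign. Qed.

Lemma symdiff_eq0 A B : (symdiff A B == set0) = (A == B).
Proof.
apply/eqP/eqP => [AB|->]; apply/setP => i; last by rewrite in_symdiff addbb inE.
by have := in_symdiff A B i; rewrite AB inE; case: (i \in A); case: (i \in B).
Qed.

Lemma symdiffK A B : symdiff (symdiff A B) A = B.
Proof.
by apply/setP => i; rewrite !in_symdiff addbAC addbb.
Qed.

(** As [blade A * blade A] is the scalar [sgn A A], each blade goes to its inverse: this is the
    anti-automorphism that negates vectors, and the adjoint for [dot]. *)
Definition star x : Cl := [ffun A => sgn A A * x A].

Fact star_linear : linear star.
Proof.
by move=> a x y; apply/ffunP => A; rewrite !ffunE mulrDr /GRing.scale /= mulrCA.
Qed.
HB.instance Definition _ := GRing.isLinear.Build R Cl Cl _ star star_linear.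

Lemma star_blade A : star (blade R A) = sgn A A *: blade R A.
Proof.
apply/ffunP => B; rewrite !ffunE /GRing.scale /=.
by case: eqVneq => [->|] //; rewrite !mulr0.
Qed.

Lemma starK : involutive star.
Proof. by move=> x; apply/ffunP => A; rewrite !ffunE mulrA clifford_sign_sqr mul1r. Qed.

(** On blades this is the bimultiplicativity of [clifford_sign] with respect to [symdiff]. *)
Lemma starM x y : star (x * y) = star y * star x.
Proof.
rewrite (cliffordE x) mulr_suml !linear_sum mulr_sumr; apply: eq_bigr => A _.
rewrite -scalerAl !linearZ /= -scalerAr; congr (_ *: _).
rewrite (cliffordE y) mulr_sumr !linear_sum mulr_suml; apply: eq_bigr => B _.
rewrite -scalerAr !linearZ /= -scalerAl; congr (_ *: _).
rewrite !star_blade -scalerAl -scalerAr !blade_mul linearZ /= star_blade !scalerA.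
rewrite (symdiffC B A); congr (_ *: _).
rewrite clifford_sign_symdiffl !clifford_sign_symdiffr.
have AB2 := clifford_sign_sqr A B.
by ring: AB2.
Qed.

Lemma star_gen i : star (gen R i) = - gen R i.
Proof.
rewrite star_blade sign_gen_blade set11.
have -> : before i [set i] = set0.
  by apply/setP=> a; rewrite !inE; case: eqVneq => //= ->; rewrite ltnn.
by rewrite cards0 mulr1 scaleN1r.
Qed.

Lemma star_blade_reversal A :
  star (blade R A) = (-1) ^+ #|A| *: reversal (blade R A).
Proof.
rewrite reversal_blade bladeE cardE; elim: (enum A) => [|i s IHs].
  rewrite big_nil scale1r -[1]/(blade R set0) star_blade clifford_sign0s.
  by rewrite scale1r.
rewrite big_cons starM IHs star_gen rev_cons big_rcons /= exprS mulN1r scaleNr.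
by rewrite mulrN scalerAl.
Qed.

Lemma clifford_sign_diag A : sgn A A = (-1) ^+ (#|A| + 'C(#|A|, 2)).
Proof.
have := star_blade_reversal A; rewrite star_blade reversal_blade prod_rev_enum.
rewrite scalerA -exprD => /ffunP/(_ A).
by rewrite !ffunE eqxx /GRing.scale /= !mulr1.
Qed.

(** Both maps reverse products, and [star] also negates each generator. This turns the hypothesis
    [reversal T = T] into self-adjointness. *)
Lemma star_even x : is_even x -> star x = reversal x.
Proof.
move=> xE; rewrite {1}(cliffordE x) linear_sum; apply: eq_bigr => A _.
rewrite linearZ /= star_blade_reversal reversal_blade.
have [->|/xE Ae] := eqVneq (x A) 0; first by rewrite !scale0r.
by rewrite -signr_odd (negPf Ae) scale1r.
Qed.

Definition dot x y : R := \sum_A x A * y A.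

Lemma dotC x y : dot x y = dot y x.
Proof. by apply: eq_bigr => A _; rewrite mulrC. Qed.

Fact dot_linear x : scalar (dot x).
Proof.
move=> a y z; rewrite mulr_sumr -big_split; apply: eq_bigr => A _ /=.
by rewrite !ffunE /GRing.scale /=; ring.
Qed.
HB.instance Definition _ x :=
  GRing.isLinear.Build R Cl R _ (dot x) (dot_linear x).

Lemma dotBZl a x y z : dot (x - a *: y) z = dot x z - a * dot y z.
Proof. by rewrite dotC linearB linearZ /= !(dotC z). Qed.

Lemma coef0_mul x y : (x * y) set0 = \sum_A sgn A A * (x A * y A).
Proof.
rewrite [x * y]/(clifford_mul x y) /clifford_mul sum_ffunE.
apply: eq_bigr => A _; rewrite sum_ffunE (bigD1 A) //= big1 => [|B nBA].
  by rewrite addr0 !ffunE (eq_sym set0) symdiff_eq0 eqxx /GRing.scale /= mulr1 mulrC.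
by rewrite !ffunE (eq_sym set0) symdiff_eq0 eq_sym (negPf nBA) /GRing.scale /= mulr0.
Qed.

(** The coefficient at [set0] is a trace. *)
Lemma coef0_mulC x y : (x * y) set0 = (y * x) set0.
Proof. by rewrite !coef0_mul; apply: eq_bigr => A _; rewrite (mulrC (x A)). Qed.

Lemma dotE x y : dot x y = (star x * y) set0.
Proof.
rewrite coef0_mul; apply: eq_bigr => A _.
by rewrite ffunE !mulrA clifford_sign_sqr mul1r.
Qed.

(** Cyclicity of the trace makes bracketing with [star x] adjoint to bracketing with [x]. *)
Lemma dot_lie z x y : dot z (lie x y) = dot (lie (star x) z) y.
Proof.
rewrite !dotE !linearB /= !starM !starK mulrBl mulrBr !ffunE.
by rewrite !mulrA [in X in _ - X = _]coef0_mulC !mulrA.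
Qed.

Lemma star_lie x y : star (lie x y) = lie (star y) (star x).
Proof. by rewrite linearB /= !starM. Qed.

Lemma gen_conj_coef i x A :
  (gen R i * x * gen R i) A = - (-1) ^+ (#|A| + (i \in A)) * x A.
Proof.
have bE B : gen R i * blade R B * gen R i =
    - (-1) ^+ (#|B| + (i \in B)) *: blade R B.
  rewrite /gen blade_mul -scalerAl blade_mul scalerA symdiffK.
  rewrite clifford_sign_symdiffl (sign_gen_blade _ i B) (sign_blade_gen _ i B).
  (* Reads off [sgn [set i] [set i] = -1]. *)
  have := star_gen i; rewrite star_blade => /ffunP/(_ [set i]).
  rewrite !ffunE eqxx /GRing.scale /= mulr1 => ->; congr (_ *: _).
  have b2 : (-1) ^+ #|before i B| * (-1) ^+ #|before i B| = 1 :> R.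
    by rewrite -expr2 sqrr_sign.
  by rewrite exprD; ring: b2.
rewrite {1}(cliffordE x) mulr_sumr mulr_suml sum_ffunE (bigD1 A) //= big1 => [|B nBA].
  by rewrite addr0 -scalerAr -scalerAl bE !ffunE eqxx /GRing.scale /= mulr1 mulrC.
by rewrite -scalerAr -scalerAl bE !ffunE eq_sym (negPf nBA) /GRing.scale /= !mulr0.
Qed.

End CliffordStar.

(** * The volume element and parity *)

Section Volume.
Variables (R : comNzRingType) (n : nat).
Local Notation Cl := (clifford R n).
Local Notation nu := (volume R n).
Implicit Types (A B C : {set 'I_n}) (i j : 'I_n) (x y z : Cl).

Lemma volumeE : nu = blade R setT.
Proof.
rewrite bladeE /volume; congr (\big[_/_]_(i <- _) _).
by rewrite enum_setT.
Qed.

Lemma volume_gen i : ~~ odd n -> nu * gen R i = - (gen R i * nu).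
Proof.
move=> n_even; rewrite volumeE /gen !blade_mul symdiffC sign_gen_blade sign_blade_gen.
by rewrite inE cardsT card_ord -signr_odd (negPf n_even) mul1r mulN1r scaleNr opprK.
Qed.

Lemma volume_blade A : ~~ odd n ->
  nu * blade R A = (-1) ^+ #|A| *: (blade R A * nu).
Proof.
move=> n_even; rewrite bladeE cardE; elim: (enum A) => [|i s IHs].
  by rewrite big_nil mulr1 mul1r scale1r.
rewrite big_cons mulrA volume_gen // mulNr -[gen R i * nu * _]mulrA IHs /= exprS mulN1r scaleNr.
by rewrite -scalerAr mulrA.
Qed.

Hypothesis n4 : (n %% 4 = 0)%N.

Lemma mod4_even : ~~ odd n.
Proof. by rewrite (divn_eq n 4) n4 addn0 oddM andbF. Qed.

(** When 4 divides [n], both [n] and ['C(n, 2)] are even. *)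
Lemma volume_sign : clifford_sign R [set: 'I_n] setT = 1.
Proof.
rewrite clifford_sign_diag cardsT card_ord -signr_odd oddD (negPf mod4_even).
rewrite (divn_eq n 4) n4 addn0 bin2.
by rewrite mulnAC -[X in (_ * X)%N]/(2 * 2)%N mulnA !muln2 half_double odd_double.
Qed.

Lemma volume_sqr : nu * nu = 1.
Proof.
rewrite volumeE blade_mul volume_sign scale1r; congr (blade R _).
by apply/eqP; rewrite symdiff_eq0.
Qed.

Lemma star_volume : star nu = nu.
Proof. by rewrite volumeE star_blade volume_sign scale1r. Qed.

(** Conjugation by [nu] is the parity involution; odd and even are therefore expressed below as
    anticommuting and commuting with [nu]. *)
Lemma volume_conj_coef x A : (nu * x * nu) A = (-1) ^+ #|A| * x A.
Proof.
rewrite {1}(cliffordE x) mulr_sumr mulr_suml sum_ffunE (bigD1 A) //= big1 => [|B nBA].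
  rewrite addr0 -scalerAr volume_blade ?mod4_even // -2!scalerAl -mulrA volume_sqr mulr1.
  by rewrite !ffunE eqxx /GRing.scale /= mulr1 mulrC.
rewrite -scalerAr volume_blade ?mod4_even // -2!scalerAl -mulrA volume_sqr mulr1.
by rewrite !ffunE eq_sym (negPf nBA) /GRing.scale /= !mulr0.
Qed.

Lemma volume_comm_even x : is_even x -> nu * x = x * nu.
Proof.
move=> x_even; suff {2}<- : nu * x * nu = x by rewrite -!mulrA volume_sqr mulr1.
apply/ffunP => A; rewrite volume_conj_coef.
have [->|/x_even eA] := eqVneq (x A) 0; first by rewrite mulr0.
by rewrite -signr_odd (negPf eA) mul1r.
Qed.

End Volume.

(** * Odd elements and faithfulness of Clifford modules *)

Section OddElements.
Variables (R : realFieldType) (n : nat).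
Hypothesis n4 : (n %% 4 = 0)%N.
Local Notation Cl := (clifford R n).
Local Notation nu := (volume R n).
Implicit Types (A B C : {set 'I_n}) (i j : 'I_n) (x y z w : Cl).

Lemma volume_anticomm_odd x A : nu * x = - (x * nu) -> ~~ odd #|A| -> x A = 0.
Proof.
move=> x_odd A_even; have := volume_conj_coef n4 x A.
rewrite x_odd mulNr -mulrA volume_sqr // mulr1 -signr_odd (negPf A_even) mul1r ffunE.
by move=> E; lra.
Qed.

Lemma odd_dot_even x y : nu * x = - (x * nu) -> nu * y = y * nu -> dot x y = 0.
Proof.
move=> x_odd y_even; apply: big1 => A _; have [A_odd|A_even] := boolP (odd #|A|).
  have := volume_conj_coef n4 y A.
  rewrite y_even -mulrA volume_sqr // mulr1 -signr_odd A_odd mulN1r => E.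
  have -> : y A = 0 by lra.
  by rewrite mulr0.
by rewrite volume_anticomm_odd // mul0r.
Qed.

(** An odd set [A] contains some [i] and misses some [j], as [n] is even; the
    coefficient of [gen i * w * gen i] at [A] is [- w A], that of
    [gen j * w * gen j] is [w A]. *)
Lemma odd_conj_const_eq0 w y : nu * w = - (w * nu) ->
  (forall i, gen R i * w * gen R i = y) -> w = 0.
Proof.
move=> w_odd wy; apply/ffunP => A; rewrite [RHS]ffunE.
have [A_odd|/volume_anticomm_odd->//] := boolP (odd #|A|).
have [i iA] : exists i, i \in A.
  by apply/set0Pn; apply: contraTneq A_odd => ->; rewrite cards0.
have [j jA] : exists j, j \in ~: A.
  apply/set0Pn; apply: contraTneq A_odd => /(congr1 (@setC _)).
  by rewrite setCK setC0 => ->; rewrite cardsT card_ord mod4_even.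
have := congr1 (fun x : Cl => x A) (etrans (wy i) (esym (wy j))).
rewrite !gen_conj_coef iA; rewrite inE in jA.
by rewrite (negPf jA) addn0 addn1 exprS -signr_odd A_odd; lra.
Qed.

(** The inverse of [gen i] is [- gen i], so each step adds to [y] its conjugate by [gen i]. Over all
    [i] this is [2 ^+ n] times the mean over conjugations by blades. *)
Definition average (s : seq 'I_n) x : Cl :=
  foldr (fun i y => y - gen R i * y * gen R i) x s.

Lemma average_coef s x A :
  average s x A = (\prod_(i <- s) (1 + (-1) ^+ (#|A| + (i \in A)))) * x A.
Proof.
elim: s => [|i s IHs]; first by rewrite big_nil mul1r.
rewrite big_cons /= ffunE [(- _ : Cl) A]ffunE gen_conj_coef IHs; ring.
Qed.

(** For nonempty [A] some factor [1 + (-1) ^+ (#|A| + (i \in A))] vanishes: take [i] in [A] if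
    [#|A|] is even, and outside [A] if it is odd, which is possible because [n] is even. *)
Lemma average_enum x : average (enum 'I_n) x = (2 ^+ n * x set0)%:A.
Proof.
apply/ffunP => A; rewrite average_coef !ffunE /GRing.scale /=.
have [->|nA0] := eqVneq A set0.
  rewrite mulr1 (eq_bigr (fun=> 2)) => [|i _]; last by rewrite cards0 inE expr0.
  by rewrite big_const_seq count_predT size_enum_ord iter_mulr_1.
rewrite mulr0.
suff [i iA] : exists i, odd (#|A| + (i \in A)).
  by rewrite (bigD1_seq i) ?mem_enum ?enum_uniq //= -signr_odd iA addrN !mul0r.
have [A_odd|A_even] := boolP (odd #|A|); last first.
  by have /set0Pn[i iA] := nA0; exists i; rewrite iA addn1.
have /set0Pn[j] : ~: A != set0.
  apply: contraTneq A_odd => /(congr1 (@setC _)).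
  by rewrite setCK setC0 => ->; rewrite cardsT card_ord mod4_even.
by rewrite inE => /negPf jA; exists j; rewrite jA addn0.
Qed.

Lemma dot_eq0 x : dot x x = 0 -> x = 0.
Proof.
move/eqP; rewrite psumr_eq0 => [/allP x0|A _]; last by rewrite -expr2 sqr_ge0.
apply/ffunP => A; rewrite [RHS]ffunE.
by have := x0 A (mem_index_enum A); rewrite mulf_eq0 orbb => /eqP.
Qed.

(** The annihilator of [S] is a two-sided ideal, so with [x] it contains the full average of
    [star x * x]. That is the scalar [2 ^+ n * dot x x], which kills [s] only if it is 0. *)
Lemma clifford_module_faithful (S : lmodType Cl) (s : S) x : s <> 0 ->
  (forall psi : S, x *: psi = 0) -> x = 0.
Proof.
move=> s0 x0; apply: dot_eq0; rewrite dotE.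
have {}x0 psi : (star x * x) *: psi = 0 :> S by rewrite -scalerA x0 scaler0.
have : forall r psi, average r (star x * x) *: psi = 0 :> S.
  elim=> [|i r IHr] psi //=.
  by rewrite scalerBl -!scalerA !IHr scaler0 subr0.
move/(_ (enum 'I_n) s); rewrite average_enum; set a := (_ * _ : R) => as0.
apply: contra_notP s0 => /eqP nz.
have nza : a != 0 by rewrite mulf_neq0 // expf_neq0 // pnatr_eq0.
have a1 : (a^-1)%:A * a%:A = 1 :> Cl by rewrite mulr_algl scalerA mulVf // scale1r.
by rewrite -[s]scale1r -a1 -scalerA as0 scaler0.
Qed.

End OddElements.

(** * Orthogonal projection onto subspaces *)

Lemma linear_subspace_vspace (K : fieldType) (W : vectType K) (U : set W) :
  linear_subspace U -> exists E : {vspace W}, forall x, U x <-> x \in E.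
Proof.
move=> [U0 Ulin].
(* An [E] inside [U] of maximal dimension is all of [U], as it already absorbs each line spanned by
   an element of [U]. *)
pose P k := `[< exists2 E : {vspace W}, \dim E = k & forall x, x \in E -> U x >].
have exP : exists k, P k.
  exists 0%N; apply/asboolP; exists 0%VS => [|x]; first exact: dimv0.
  by rewrite memv0 => /eqP ->.
have Pbound k : P k -> (k <= \dim {:W})%N.
  by move/asboolP => [E <- _]; rewrite dimvS ?subvf.
case: (ex_maxnP exP Pbound) => k /asboolP[E dimE EU] kmax; exists E => x.
split=> [Ux|]; last exact: EU.
have /kmax : P (\dim (E + <[x]>)).
  apply/asboolP; exists (E + <[x]>)%VS => // y /memv_addP[u uE [_ /vlineP[a ->] ->]].
  by rewrite addrC; apply: Ulin => //; apply: EU.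
rewrite -dimE => dimEx.
have /eqP -> : E == (E + <[x]>)%VS by rewrite eqEdim addvSl.
by rewrite memvE addvSr.
Qed.

Section Projection.
Variables (R : realFieldType) (n : nat).
Local Notation Cl := (clifford R n).
Implicit Types (x y v : Cl).

Lemma dot_span (X : seq Cl) x :
  {in X, forall v, dot x v = 0} -> {in <<X>>%VS, forall v, dot x v = 0}.
Proof.
move=> xX v /(coord_span (X := in_tuple X)) ->.
rewrite linear_sum big1 // => i _.
by rewrite linearZ /= xX ?mulr0 // mem_nth.
Qed.

(** Gram-Schmidt: [w] is the part of the new vector [v] orthogonal to the span of [X], and the
    projection of [x] gains its component along [w]. *)
Lemma dot_projection_span (X : seq Cl) x :
  exists2 u, u \in <<X>>%VS & {in <<X>>%VS, forall v, dot (x - u) v = 0}.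
Proof.
elim: X x => [|v X IHX] x.
  by exists 0; [exact: mem0v | apply: dot_span].
have [v' v'X wX] := IHX v; set w := v - v' in wX.
have [u uX yX] := IHX x; set y := x - u in yX.
have XvX : (<<X>> <= <<v :: X>>)%VS by rewrite span_cons addvSr.
have [w0|w0] := eqVneq w 0.
  exists u; first exact: (subvP XvX).
  apply: dot_span => t; rewrite inE => /predU1P[->|/memv_span/yX//].
  by rewrite yX // -[v](subrK v') -/w w0 add0r.
have ww : dot w w != 0 by apply: contraNneq w0 => /dot_eq0/eqP.
exists (u + (dot y w / dot w w) *: w).
  rewrite memvD ?memvZ ?memvB //; try exact: (subvP XvX).
  by rewrite memv_span ?mem_head.
rewrite opprD addrA -/y.
have aX t : t \in <<X>>%VS -> dot (y - (dot y w / dot w w) *: w) t = 0.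
  by move=> tX; rewrite dotBZl (yX t) // (wX t) // mulr0 subr0.
apply: dot_span => t; rewrite inE => /predU1P[->|/memv_span/aX//].
rewrite -[v](subrK v') -/w linearD /= (aX v') // addr0.
by rewrite dotBZl divfK // subrr.
Qed.

Lemma dot_projection (U : set Cl) x : linear_subspace U ->
  exists2 u, U u & forall v, U v -> dot (x - u) v = 0.
Proof.
move=> /linear_subspace_vspace[E UE].
have [u uE xu] := dot_projection_span (vbasis E) x.
rewrite (span_basis (vbasisP E)) in uE xu.
by exists u => [|v /UE/xu//]; apply/UE.
Qed.

End Projection.

(** * Generated and derived Lie algebras *)

Section LieAlgebras.
Variables (R : comNzRingType) (W : algType R).
Implicit Types (x y : W) (U G : set W).

Lemma linear_subspaceB U x y : linear_subspace U -> U x -> U y -> U (x - y).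
Proof. by move=> [_ U_lin] Ux Uy; rewrite addrC -scaleN1r; apply: U_lin. Qed.

Lemma generated_lie_subalgebraP G : lie_subalgebra (generated_lie_subalgebra G).
Proof.
split; first split; first by move=> U [[[U0 _] _] _].
- move=> a x y Gx Gy U GU; have [[[_ U_lin] _] _] := GU.
  by apply: U_lin; [apply: Gx | apply: Gy].
- move=> x y Gx Gy U GU; have [[_ U_lie] _] := GU.
  by apply: U_lie; [apply: Gx | apply: Gy].
Qed.

Lemma derived_algebra_subspace U : linear_subspace (derived_algebra U).
Proof.
split=> [D [[D0 _] _] //|a x y Ux Uy D UD]; have [[_ D_lin] _] := UD.
by apply: D_lin; [apply: Ux | apply: Uy].
Qed.

Lemma lie_derived U x y : U x -> U y -> derived_algebra U (lie x y).
Proof. by move=> Ux Uy D [_ UD]; apply: UD; exists x, y. Qed.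

Lemma derived_algebra_sub U : lie_subalgebra U -> (derived_algebra U `<=` U)%classic.
Proof.
by move=> [U_lin U_lie] x; apply; split=> // _ [y [z [Uy Uz ->]]]; apply: U_lie.
Qed.

End LieAlgebras.

Section Interior.
Variables (R : comNzRingType) (n : nat).
Local Notation Cl := (clifford R n).

(** [mul_gen] handles a single degree; an even element may mix degrees, but the sign is 1 in each of
    them. *)
Lemma mul_gen_even i (x : Cl) : is_even x ->
  x * gen R i = wedge_gen i x + interior_gen i x.
Proof.
move=> x_even.
rewrite {1}(cliffordE x) mulr_suml (bigID (fun A : {set _} => i \in A)) /= addrC.
have E A : x A *: (blade R A * gen R i) = x A *:
    ((-1) ^+ #|before i A| *: blade R (if i \in A then A :\ i else i |: A)).
  have [->|/x_even eA] := eqVneq (x A) 0; first by rewrite !scale0r.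
  by rewrite blade_mul_gen -signr_odd (negPf eA) scale1r.
by congr (_ + _); apply: eq_bigr => A iA; rewrite -scalerAl E ?iA ?(negPf iA).
Qed.

End Interior.

(** * The fix algebra, elements centralizing its generators, and perfectness *)

Section FixAlgebra.
Variables (R : realType) (n : nat) (V : vectType R).
Variables (ip : {dot V for idfun}) (e : n.-tuple V) (T : clifford R n).
Hypotheses (n4 : (n %% 4)%N = 0%N) (T_even : is_even T).
Local Notation Cl := (clifford R n).
Local Notation nu := (volume R n).
Local Notation vector := (vector ip e).
Implicit Types (X : V) (x y z : Cl).

(** Left and right multiplication by a generator share the wedge term and have opposite interior
    terms. *)
Lemma interior_even X :
  interior ip e X T = 2^-1 *: (T * vector X - vector X * T).
Proof.
rewrite /vector mulr_sumr mulr_suml -sumrB scaler_sumr; apply: eq_bigr => i _.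
rewrite -scalerAr -scalerAl -scalerBr mul_gen_even // gen_mul opprD opprK.
rewrite addrACA subrr add0r -[X in _ = _ *: (_ *: X)]mulr2n -scaler_nat !scalerA.
by rewrite -?mulrA mulrCA mulVf ?pnatr_eq0 // mulr1.
Qed.

Lemma volume_vector X : nu * vector X = - (vector X * nu).
Proof.
rewrite mulr_sumr mulr_suml -sumrN; apply: eq_bigr => i _.
by rewrite -scalerAr -scalerAl volume_gen ?mod4_even // scalerN.
Qed.

Lemma interior_odd X : nu * interior ip e X T = - (interior ip e X T * nu).
Proof.
have nuT := volume_comm_even n4 T_even.
rewrite interior_even -scalerAr -scalerAl -scalerN mulrBr mulrBl opprB.
by rewrite !mulrA nuT volume_vector mulNr -!mulrA nuT volume_vector mulrN opprK addrC.
Qed.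

Lemma interior0 : interior ip e 0 T = 0.
Proof. by rewrite interior_even linear0 mulr0 mul0r subrr scaler0. Qed.

Lemma interiorPl a X Y :
  interior ip e (a *: X + Y) T = a *: interior ip e X T + interior ip e Y T.
Proof.
rewrite !interior_even linearP mulrDr mulrDl -scalerAr -scalerAl opprD addrACA.
by rewrite -scalerBr scalerDr !scalerA mulrC.
Qed.

Lemma star_vector X : star (vector X) = - vector X.
Proof.
rewrite linear_sum -sumrN; apply: eq_bigr => i _.
by rewrite linearZ /= star_gen scalerN.
Qed.

Hypothesis star_T : star T = T.

Lemma star_interior X : star (interior ip e X T) = interior ip e X T.
Proof.
rewrite interior_even linearZ linearB /= !starM star_vector star_T.
by rewrite mulNr mulrN opprK addrC.
Qed.

Lemma fix_algebra_lie : lie_subalgebra (fix_algebra ip e T).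
Proof. exact: generated_lie_subalgebraP. Qed.

Lemma fix_algebra_interior X : fix_algebra ip e T (interior ip e X T).
Proof. by move=> U [_ TU]; apply: TU; exists X. Qed.

(** The elements whose [star] also lies in the fix algebra form a Lie subalgebra containing the
    self-adjoint generators. *)
Lemma fix_algebra_star x : fix_algebra ip e T x -> fix_algebra ip e T (star x).
Proof.
have [[g0 g_lin] g_lie] := fix_algebra_lie.
pose U := [set y | fix_algebra ip e T y /\ fix_algebra ip e T (star y)]%classic.
suff gU : (fix_algebra ip e T `<=` U)%classic by move=> /gU[].
move=> y; apply; split; first split; first split.
- by split; rewrite ?linear0.
- move=> a u v [gu gu'] [gv gv']; split; first exact: g_lin.
  by rewrite linearP; apply: g_lin.
- move=> u v [gu gu'] [gv gv']; split; first exact: g_lie.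
  by rewrite star_lie; apply: g_lie.
- move=> _ [X _ <-]; split; last rewrite star_interior; exact: fix_algebra_interior.
Qed.

(** Elements with this property form a Lie subalgebra: brackets lie in the derived algebra, and
    linearity in [X] merges sums of generators into one. *)
Lemma fix_algebra_mod_derived x : fix_algebra ip e T x ->
  exists X, derived_algebra (fix_algebra ip e T) (x - interior ip e X T).
Proof.
have [[g0 g_lin] g_lie] := fix_algebra_lie.
have [D0 D_lin] := derived_algebra_subspace (fix_algebra ip e T).
pose U := [set y | fix_algebra ip e T y /\
  exists X, derived_algebra (fix_algebra ip e T) (y - interior ip e X T)]%classic.
suff gU : (fix_algebra ip e T `<=` U)%classic by move=> /gU[].
move=> y; apply; split; first split; first split.
- by split=> //; exists 0; rewrite interior0 subr0.
- move=> a u v [gu [X uX]] [gv [Y vY]]; split; first exact: g_lin.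
  exists (a *: X + Y).
  by rewrite interiorPl opprD addrACA -scalerBr; apply: D_lin.
- move=> u v [gu _] [gv _]; split; first exact: g_lie.
  by exists 0; rewrite interior0 subr0; apply: lie_derived.
- move=> _ [X _ <-]; split; first exact: fix_algebra_interior.
  by exists X; rewrite subrr.
Qed.

(** By [dot_lie] the squared norm of [lie (star a) z] is [dot z (lie a (lie (star a) z))], which
    vanishes as the outer bracket is derived. *)
Lemma orthogonal_derived_comm z a : fix_algebra ip e T z ->
  (forall v, derived_algebra (fix_algebra ip e T) v -> dot z v = 0) ->
  fix_algebra ip e T a -> lie (star a) z = 0.
Proof.
have [_ g_lie] := fix_algebra_lie.
move=> gz zD ga; apply: dot_eq0; rewrite -dot_lie; apply: zD.
by apply: lie_derived => //; apply: g_lie => //; apply: fix_algebra_star.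
Qed.

Hypothesis nuT : nu * T = T.
Hypotheses (dimV : \dim {:V} = n) (e_on : orthonormal ip e).

Let Tnu : T * nu = T.
Proof. by rewrite -volume_comm_even. Qed.

Lemma odd_comm_mul_eq0 z : nu * z = - (z * nu) ->
  (forall X, lie (interior ip e X T) z = 0) -> T * z = 0.
Proof.
move=> z_odd zT.
apply: (odd_conj_const_eq0 n4 (y := z * T)) => [|i].
  by rewrite mulrA nuT -mulrA -[z * nu]opprK -z_odd mulrN opprK mulrA Tnu.
have g_odd : nu * gen R i = - (gen R i * nu) by rewrite volume_gen ?mod4_even.
have := zT (tnth e i); rewrite interior_even /lie -scalerAl -scalerAr -scalerBr.
rewrite vector_frame // => /eqP; rewrite scaler_eq0 invr_eq0 pnatr_eq0 /= => /eqP E.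
have E1 : T * gen R i * z - gen R i * T * z = z * T * gen R i - z * gen R i * T.
  by move: E; rewrite mulrBl mulrBr !mulrA => /subr0_eq.
(* Left multiplication by [nu] separates the two blocks of the commutator. *)
have {E} E2 : T * gen R i * z + gen R i * T * z = - (z * T * gen R i) - z * gen R i * T.
  have n1 : nu * (gen R i * T * z) = - (gen R i * T * z).
    by rewrite !mulrA g_odd !mulNr -(mulrA _ nu) nuT.
  have n2 : nu * (z * T * gen R i) = - (z * T * gen R i).
    by rewrite !mulrA z_odd !mulNr -(mulrA z nu) nuT.
  have n3 : nu * (z * gen R i * T) = z * gen R i * T.
    by rewrite !mulrA z_odd !mulNr -(mulrA z nu) g_odd mulrN mulNr opprK mulrA -(mulrA _ nu) nuT.
  have := congr1 (fun x => nu * x) E1; rewrite !mulrBr n1 n2 n3 opprK => <-.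
  by rewrite !mulrA nuT.
(* [E2] minus [E1] is twice this identity. *)
have -> : gen R i * (T * z) = - (z * T * gen R i).
  apply/ffunP => A; move/(congr1 (fun x : Cl => x A)): E1.
  move/(congr1 (fun x : Cl => x A)): E2; rewrite !mulrA !ffunE.
  by move=> E2 E1; lra.
by rewrite mulNr -(mulrA (z * T)) gen_sqr mulrN1 opprK.
Qed.

Variables (S : lmodType Cl) (s : S).
Hypotheses (s_neq0 : s <> 0) (Z0 : fixed_spinors ip e T S = [set 0]%classic).

(** [(1 + nu) * z * psi] lies in [S^+] and is killed by [T], hence is a fixed
    spinor. *)
Lemma odd_comm_volume_mul z : nu * z = - (z * nu) ->
  (forall X, lie (interior ip e X T) z = 0) -> (1 + nu) * z = 0.
Proof.
move=> z_odd zT; have Tz := odd_comm_mul_eq0 z_odd zT.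
apply: (clifford_module_faithful n4 s_neq0) => psi.
suff : fixed_spinors ip e T S (((1 + nu) * z) *: psi) by rewrite Z0.
move=> X; rewrite scalerA interior_even -scalerAl mulrBl.
have -> : vector X * T * ((1 + nu) * z) = 0.
  by rewrite mulrA -(mulrA (vector X)) mulrDr mulr1 Tnu -mulrA mulrDl Tz addr0 mulr0.
(* Moving [nu] left across [vector X] flips its sign and [T] absorbs it, so
   [T * vector X * (1 + nu) = 0]. *)
have -> : T * vector X * ((1 + nu) * z) = 0.
  rewrite mulrA mulrDr mulr1.
  rewrite -[T * vector X * nu]mulrA -[vector X * nu]opprK -volume_vector.
  by rewrite mulrN mulrA Tnu subrr mul0r.
by rewrite subr0 scaler0 scale0r.
Qed.

(** The generators are self-adjoint, so [star z] satisfies the same hypotheses and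
    [z * (1 + nu) = 0]. Since [z] is odd this says [(1 - nu) * z = 0]; adding [(1 + nu) * z = 0]
    gives [2 z = 0]. *)
Lemma odd_comm_eq0 z : nu * z = - (z * nu) ->
  (forall X, lie (interior ip e X T) z = 0) -> z = 0.
Proof.
move=> z_odd zT; have := odd_comm_volume_mul z_odd zT.
have sz_odd : nu * star z = - (star z * nu).
  rewrite -(star_volume R n4) -!starM.
  by rewrite z_odd linearN opprK.
have szT X : lie (interior ip e X T) (star z) = 0.
  rewrite -star_interior -star_lie -[lie _ _]opprK /lie opprB.
  by rewrite -[_ - _]/(lie _ _) zT oppr0 linear0.
have /(congr1 (@star R n)) := odd_comm_volume_mul sz_odd szT.
rewrite starM starK linearD /= star_volume // linear0 -[star 1]/(star (blade R set0)).
rewrite star_blade clifford_sign0s scale1r -[blade R set0]/(1 : Cl).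
rewrite mulrDl mulrDr mul1r mulr1 z_odd => E1 E2.
apply/ffunP => A; move/(congr1 (fun x : Cl => x A)): E1.
by move/(congr1 (fun x : Cl => x A)): E2; rewrite !ffunE => E2 E1; lra.
Qed.

(** Twice the odd part of [z] is [z - nu * z * nu]. It still commutes with the generators, because
    they anticommute with [nu] and the two signs cancel. *)
Lemma comm_even z : (forall X, lie (interior ip e X T) z = 0) -> nu * z = z * nu.
Proof.
move=> zT; have nu2 := volume_sqr R n4.
have : z - nu * z * nu = 0.
  apply: odd_comm_eq0 => [|X].
    by rewrite mulrBr mulrBl !mulrA nu2 mul1r -(mulrA _ nu nu) nu2 mulr1 opprB.
  have /subr0_eq qz := zT X; have q_odd := interior_odd X.
  set q := interior _ _ _ _ in qz q_odd *.
  have qnu : q * nu = - (nu * q) by rewrite q_odd opprK.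
  have -> : lie q (z - nu * z * nu) = nu * z * nu * q - q * (nu * z * nu).
    by rewrite /lie mulrBr mulrBl qz opprB addrC addrA subrK.
  rewrite -(mulrA (nu * z)) q_odd mulrN (mulrA (nu * z) q) -(mulrA nu z q) -qz !mulrA qnu.
  by rewrite !mulNr subrr.
by move/subr0_eq => E; rewrite {2}E -!mulrA nu2 mulr1.
Qed.

Lemma fix_algebra_perfect : perfect_lie_algebra (fix_algebra ip e T).
Proof.
have g_alg := fix_algebra_lie; have Dg := derived_algebra_sub g_alg.
apply/seteqP; split=> // x gx.
have [u Du zD] := dot_projection x (derived_algebra_subspace (fix_algebra ip e T)).
set z := x - u in zD; suff z0 : z = 0 by rewrite -[x](subrK u) -/z z0 add0r.
have gz : fix_algebra ip e T z by apply: linear_subspaceB (g_alg.1) gx (Dg _ Du).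
have zT X : lie (interior ip e X T) z = 0.
  rewrite -[interior ip e X T]star_interior.
  exact: orthogonal_derived_comm (fix_algebra_interior X).
have [X DX] := fix_algebra_mod_derived gz.
(* In [dot z z] the second [z] splits into a derived element, orthogonal to [z], and an odd
   generator, orthogonal to the even [z]. *)
apply: dot_eq0; rewrite -{2}[z](subrK (interior ip e X T)) linearD /= (zD _ DX) add0r.
by rewrite dotC; apply: odd_dot_even (interior_odd X) (comm_even zT).
Qed.

End FixAlgebra.

Theorem theorem1p1 (R : realType) (n : nat) (V : vectType R)
    (ip : {dot V for idfun}) (o e : n.-tuple V)
    (S : lmodType (clifford R n)) (T : clifford R n) :
  (n %% 4)%N = 0%N ->
  \dim {:V} = n ->
  basis_of {:V} o ->
  orthonormal ip e ->
  same_orientation e o ->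
  irreducible_module S ->
  is_even T ->
  volume R n * T = T ->
  reversal T = T ->
  fixed_spinors ip e T S = [set 0]%classic ->
  perfect_lie_algebra (fix_algebra ip e T).
Proof.
move=> n4 dimV _ e_on _ [[s s0] _] T_even nuT T_rev Z0.
by apply: fix_algebra_perfect s0 Z0 => //; rewrite star_even.
Qed.
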